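(* Let $\gamma_A$ be the position vectors of the known world-lines $\gamma_A(\tau^A)$, $A=1,2,3,4$, of the four emitters of a positioning system in Minkowski space-time with respect to an inertial coordinate system. Then the users of the central region $\mathcal{C}^C$ of the positioning system can obtain their position $\{x^\alpha\}$ in the inertial system by computation from their sole emission coordinates $\{\tau^A\}$.
   Context: Minkowski space-time is identified, via a choice of origin of an inertial chart, with a 4-dimensional real oriented and time-oriented vector space with Lorentzian inner product $\cdot$ of signature $2\epsilon$, $\epsilon=\pm1$ fixed ($\epsilon=+1$: $(-,+,+,+)$; $\epsilon=-1$: $(+,-,-,-)$). Write $v^2=v\cdot v$. A time-like or nonzero null vector $v$ is future-pointing iff $\epsilon\,u\cdot v<0$ for a future-pointing time-like $u$. With $\eta$ the metric volume form, ${*}(v_1\wedge v_2\wedge v_3)$ is the vector $w$ with $w\cdot u=\eta(u,v_1,v_2,v_3)$ for all $u$. Positioning system: four distinct smooth future-directed time-like curves $\gamma_A(\tau^A)$ (the emitters) parametrized by proper time. The emission region is the set of events $x$ for which there are values $\tau^A$ such that each $m_A=x-\gamma_A(\tau^A)$ satisfies $m_A^2=0$ and $\epsilon\,u\cdot m_A<0$ for a future-pointing time-like $u$; these $\tau^A$ are the emission coordinates of $x$, i.e. the four proper times received at $x$ by light signals from the emitters. The emission coordinate region $\mathcal{C}$ is the set of such $x$ with $m_1\wedge m_2\wedge m_3\wedge m_4\neq0$. For $x\in\mathcal{C}$ with emission coordinates $(\tau^A)$, put $\gamma_A=\gamma_A(\tau^A)$, $e_a=\gamma_a-\gamma_4$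 ($a=1,2,3$) and $\chi={*}(e_1\wedge e_2\wedge e_3)$ (the configuration vector, nonzero on $\mathcal{C}$). Let $\mathcal{C}_s=\{x\in\mathcal{C}:\epsilon\chi^2<0\}$ (space-like configuration region) and $\mathcal{C}_\ell=\{x\in\mathcal{C}:\chi^2=0\}$ (null configuration region). The central region is $\mathcal{C}^C=\mathcal{C}_s\cup\mathcal{C}_\ell$. A user is an observer at an event of $\mathcal{C}$ who receives the four times $\{\tau^A\}$. The world-lines of the emitters in the inertial system and the space-time metric in it are supposed to be background data known to any user. *)

(* Defs.v *)
From HB Require Import structures.
From mathcomp Require Import all_boot all_order all_algebra ring.
From mathcomp Require Import classical_sets reals topology normedtype derive.

Set Implicit Arguments.
Unset Strict Implicit.
Unset Printing Implicit Defensive.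

Import Order.TTheory GRing.Theory Num.Theory.
Import numFieldNormedType.Exports.

Local Open Scope classical_set_scope.
Local Open Scope ring_scope.

(* The four emitters A = 1, 2, 3, 4. *)
Definition em1 : 'I_4 := @Ordinal 4 0 isT.
Definition em2 : 'I_4 := @Ordinal 4 1 isT.
Definition em3 : 'I_4 := @Ordinal 4 2 isT.
Definition em4 : 'I_4 := @Ordinal 4 3 isT.

Section Minkowski.
Variable R : realType.

(* Space-time is 'rV[R]_4, the row of the inertial coordinates x^0, ..., x^3
   (c = 1), where x^0 increases towards the future and the chart is positively
   oriented.  The signature parameter eps is 1 or -1: the inner product is
   eps * diag (-1, 1, 1, 1). *)
Definition dot (eps : R) (u v : 'rV[R]_4) : R :=
  eps * \sum_(i < 4) (if i == ord0 then -1 else 1) * (u ord0 i * v ord0 i).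

Definition sq (eps : R) (v : 'rV[R]_4) : R := dot eps v v.

Definition time_axis : 'rV[R]_4 := delta_mx ord0 ord0.

(* Only meant for v time-like, or null and nonzero; time_axis is the
   future-pointing time-like vector that fixes the time orientation. *)
Definition future_pointing (eps : R) (v : 'rV[R]_4) : Prop :=
  eps * dot eps time_axis v < 0.

(* The metric volume form: in an inertial chart |det g| = 1. *)
Definition vol (v0 v1 v2 v3 : 'rV[R]_4) : R :=
  \det (\matrix_(i < 4, j < 4) (nth 0 [:: v0; v1; v2; v3] i) ord0 j).

(* *(v1 /\ v2 /\ v3): the index of vol (_, v1, v2, v3) is raised with the
   inverse metric, which is eps * diag (-1, 1, 1, 1) because eps = 1 or -1;
   starP is the defining property. *)
Definition star (eps : R) (v1 v2 v3 : 'rV[R]_4) : 'rV[R]_4 :=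
  \row_(i < 4) (eps * (if i == ord0 then -1 else 1) *
                vol (delta_mx ord0 i) v1 v2 v3).

Lemma vol_expand (u v1 v2 v3 : 'rV[R]_4) :
  vol u v1 v2 v3 =
    \sum_(i < 4) u ord0 i * vol (delta_mx ord0 i) v1 v2 v3.
Proof.
rewrite /vol (expand_det_row _ ord0); apply: eq_bigr => i _.
rewrite mxE; congr (_ * _).
rewrite [RHS](expand_det_row _ ord0) (bigD1 i) //= big1 ?addr0 => [|j ji].
  rewrite !mxE !eqxx mul1r /cofactor; congr (_ * \det _).
  by apply/matrixP => a b; rewrite !mxE.
by rewrite !mxE (negbTE ji) andbF mul0r.
Qed.

Lemma starP (eps : R) (v1 v2 v3 u : 'rV[R]_4) : eps = 1 \/ eps = -1 ->
  dot eps (star eps v1 v2 v3) u = vol u v1 v2 v3.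
Proof.
move=> heps; have ee : eps * eps = 1.
  by case: heps => ->; rewrite ?mulr1 // mulrNN mulr1.
rewrite vol_expand /dot mulr_sumr; apply: eq_bigr => i _.
rewrite mxE; set s := (if _ then _ else _); set w := vol _ _ _ _.
have ss : s * s = 1 by rewrite /s; case: ifP; rewrite ?mulrNN mulr1.
rewrite [LHS](_ : _ = (eps * eps) * (s * s) * (u ord0 i * w)).
  by rewrite ee ss !mul1r.
by ring.
Qed.

Definition smooth_on (I : set R) (f : R -> R) : Prop :=
  forall (n : nat) (t : R), I t -> derivable (f^`(n)%classic) t 1.

Definition velocity (g : R -> 'rV[R]_4) (t : R) : 'rV[R]_4 :=
  \row_(i < 4) derive1 (fun s => g s ord0 i) t.

(* A smooth future-directed time-like curve parametrized by its proper time,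
   which ranges over the open interval I; values of g outside I are
   irrelevant. *)
Record world_line (eps : R) (I : set R) (g : R -> 'rV[R]_4) : Prop := {
  world_line_open : open I ;
  world_line_interval : is_interval I ;
  world_line_smooth : forall i : 'I_4, smooth_on I (fun t => g t ord0 i) ;
  world_line_proper : forall t, I t -> eps * sq eps (velocity g t) = -1 ;
  world_line_future : forall t, I t -> future_pointing eps (velocity g t)
}.

(* The emitters are distinct as world-lines, i.e. as subsets of space-time. *)
Record positioning_system (eps : R) := PositioningSystem {
  dom : 'I_4 -> set R ;
  pos : 'I_4 -> R -> 'rV[R]_4 ;
  pos_world_line : forall A, world_line eps (dom A) (pos A) ;
  pos_distinct : forall A B, A != B -> pos A @` dom A <> pos B @` dom B
}.

Section Regions.
Variables (eps : R) (S : positioning_system eps).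

(* The null vectors m_A = x - gamma_A(tau^A). *)
Definition signal (x : 'rV[R]_4) (tau : 'I_4 -> R) (A : 'I_4) : 'rV[R]_4 :=
  x - pos S A (tau A).

Definition emission_coordinates (x : 'rV[R]_4) (tau : 'I_4 -> R) : Prop :=
  forall A, [/\ dom S A (tau A),
                sq eps (signal x tau A) = 0 &
                future_pointing eps (signal x tau A)].

Definition emission_region : set 'rV[R]_4 :=
  [set x | exists tau, emission_coordinates x tau].

(* In dimension four, m1 /\ m2 /\ m3 /\ m4 is the multiple of
   e0 /\ e1 /\ e2 /\ e3 with coefficient vol m1 m2 m3 m4. *)
Definition coordinate_region : set 'rV[R]_4 :=
  [set x | exists2 tau, emission_coordinates x tau &
     vol (signal x tau em1) (signal x tau em2)
         (signal x tau em3) (signal x tau em4) != 0].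

Definition rel_pos (tau : 'I_4 -> R) (a : 'I_4) : 'rV[R]_4 :=
  pos S a (tau a) - pos S em4 (tau em4).

Definition configuration (tau : 'I_4 -> R) : 'rV[R]_4 :=
  star eps (rel_pos tau em1) (rel_pos tau em2) (rel_pos tau em3).

Definition spacelike_region : set 'rV[R]_4 :=
  [set x | coordinate_region x /\
     exists2 tau, emission_coordinates x tau &
       eps * sq eps (configuration tau) < 0].

Definition null_region : set 'rV[R]_4 :=
  [set x | coordinate_region x /\
     exists2 tau, emission_coordinates x tau &
       sq eps (configuration tau) = 0].

Definition central_region : set 'rV[R]_4 := spacelike_region `|` null_region.

End Regions.
End Minkowski.

(* Computations over the reals: finite algebraic expressions with integer
   constants, field operations, square roots and sign tests.  Their only inputs
   are the four received times (Time) and the known world-lines (Pos A i p is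
   the i-th inertial coordinate of gamma_A at the computed time p).  No
   constructor gives access to the event at which the times are received. *)
Inductive program : Type :=
  | Const of int
  | Time of 'I_4
  | Pos of 'I_4 & 'I_4 & program
  | Add of program & program
  | Opp of program
  | Mul of program & program
  | Inv of program
  | Sqrt of program
  | IfPos of program & program & program.

(* Inv and Sqrt are total: 0^-1 = 0, and Num.sqrt is 0 on negative numbers. *)
Fixpoint run (R : realType) (eps : R) (S : positioning_system eps)
    (tau : 'I_4 -> R) (p : program) : R :=
  match p with
  | Const z => z%:~R
  | Time A => tau A
  | Pos A i q => pos S A (run S tau q) ord0 i
  | Add q r => run S tau q + run S tau r
  | Opp q => - run S tau q
  | Mul q r => run S tau q * run S tau r
  | Inv q => (run S tau q)^-1
  | Sqrt q => Num.sqrt (run S tau q)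
  | IfPos c q r => if 0 < run S tau c then run S tau q else run S tau r
  end.

(* Main.v *)
(** A future timelike world-line meets the past light cone of an event at most
    once, because the inner product with a null future vector is strictly
    monotone along it; hence the received times of an event are unique.
    The vector y = x - gamma_4 satisfies y^2 = 0 and 2 y.e_a = e_a^2.  Since
    y.chi is nonzero, Cramer's rule for (xi, e_1, e_2, e_3), with xi the
    Euclidean dual of chi, gives 2 N y = p + t chi with N = xi.chi > 0 and p
    computable.  Then y^2 = 0 is the equation p^2 + 2 t p.chi + t^2 chi^2 = 0.
    It is linear when chi is null; when chi is timelike the root is the one for
    which 2 N y.chi = p.chi + t chi^2 has the sign imposed by y being future
    null, which is read off the time component of chi. *)
From mathcomp Require Import perm ring lra boolp functions.
Require Import Defs.
From mathcomp Require Import all_boot all_order all_algebra.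
From mathcomp Require Import classical_sets reals topology normedtype derive.
Import Order.TTheory GRing.Theory Num.Theory.
Import numFieldNormedType.Exports.
Local Open Scope ring_scope.

(** * Coordinate formulas and Cramer's expansion *)

(* Indexing by nat makes all index arithmetic compute; out-of-range indices
   fall back to 0. *)
Definition ncoord {R : realType} (v : 'rV[R]_4) (k : nat) : R :=
  v ord0 (inord k).

Lemma sum4 {R : realType} (F : 'I_4 -> R) :
  \sum_(i < 4) F i = F (inord 0) + F (inord 1) + F (inord 2) + F (inord 3).
Proof.
rewrite !big_ord_recl big_ord0 addr0 !addrA.
by do !congr (_ + _); congr F; apply: val_inj; rewrite /= inordK.
Qed.

Lemma ncoord_ext {R : realType} (u v : 'rV[R]_4) :
  ncoord u 0 = ncoord v 0 -> ncoord u 1 = ncoord v 1 ->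
  ncoord u 2 = ncoord v 2 -> ncoord u 3 = ncoord v 3 -> u = v.
Proof.
move=> h0 h1 h2 h3; apply/rowP => i; rewrite -[i]inord_val.
by case: i => [[|[|[|[|]]]] lti].
Qed.

(** Laplace expansion into complementary 2 by 2 minors of rows 0, 1 and rows 2, 3. *)
Lemma det4E {R : realType} (F : nat -> nat -> R) :
  \det (\matrix_(i < 4, j < 4) F i j) =
  let m i j := F 0 i * F 1 j - F 0 j * F 1 i in
  let n i j := F 2 i * F 3 j - F 2 j * F 3 i in
  m 0 1 * n 2 3 - m 0 2 * n 1 3 + m 0 3 * n 1 2
  + m 1 2 * n 0 3 - m 1 3 * n 0 2 + m 2 3 * n 0 1.
Proof.
rewrite (expand_det_row _ ord0) !big_ord_recl big_ord0 /cofactor /=.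
rewrite !(expand_det_row _ ord0) !big_ord_recl !big_ord0 /cofactor /=.
rewrite !(expand_det_row _ ord0) !big_ord_recl !big_ord0 /cofactor /=.
rewrite !det_mx11 !mxE /= /bump /=.
by ring.
Qed.

Lemma volE {R : realType} (a b c d : 'rV[R]_4) :
  vol a b c d =
  let m i j := ncoord a i * ncoord b j - ncoord a j * ncoord b i in
  let n i j := ncoord c i * ncoord d j - ncoord c j * ncoord d i in
  m 0 1 * n 2 3 - m 0 2 * n 1 3 + m 0 3 * n 1 2
  + m 1 2 * n 0 3 - m 1 3 * n 0 2 + m 2 3 * n 0 1.
Proof.
rewrite -(det4E (fun i j => ncoord (nth 0 [:: a; b; c; d] i) j)) /vol.
by congr (\det _); apply/matrixP => i j; rewrite !mxE /ncoord inord_val.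
Qed.

Lemma dotE {R : realType} (eps : R) (u v : 'rV[R]_4) :
  dot eps u v = eps * (- (ncoord u 0 * ncoord v 0) + ncoord u 1 * ncoord v 1
    + ncoord u 2 * ncoord v 2 + ncoord u 3 * ncoord v 3).
Proof.
rewrite /dot sum4 -!val_eqE /= !inordK //= /ncoord.
by ring.
Qed.

Lemma ncoord_delta {R : realType} (i : 'I_4) (k : nat) : (k < 4)%N ->
  ncoord (delta_mx ord0 i : 'rV[R]_4) k = (k == i)%:R.
Proof. by move=> lk; rewrite /ncoord mxE eqxx -val_eqE /= inordK. Qed.

Lemma ncoordD {R : realType} (u v : 'rV[R]_4) k :
  ncoord (u + v) k = ncoord u k + ncoord v k.
Proof. by rewrite /ncoord mxE. Qed.

Lemma ncoordN {R : realType} (u : 'rV[R]_4) k : ncoord (- u) k = - ncoord u k.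
Proof. by rewrite /ncoord mxE. Qed.

Lemma ncoordZ {R : realType} a (u : 'rV[R]_4) k :
  ncoord (a *: u) k = a * ncoord u k.
Proof. by rewrite /ncoord mxE. Qed.

Lemma ncoord_starE {R : realType} (eps : R) (a b c : 'rV[R]_4) (k : nat) :
  (k < 4)%N ->
  ncoord (star eps a b c) k =
    eps * (if k == 0%N then -1 else 1) * vol (delta_mx ord0 (inord k)) a b c.
Proof. by move=> lk; rewrite /ncoord mxE -val_eqE /= inordK. Qed.

(** Up to the factor [vol v0 v1 v2 v3], the four [star] vectors are dual to v0, ..., v3; the order
    of their arguments absorbs the cofactor signs. Each product of a [dot] and a [star] carries
    [eps ^+ 2], which is 1. *)
Lemma cramer {R : realType} (eps : R) (y v0 v1 v2 v3 : 'rV[R]_4) :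
  eps = 1 \/ eps = -1 ->
  vol v0 v1 v2 v3 *: y =
    dot eps y v0 *: star eps v1 v2 v3 + dot eps y v1 *: star eps v2 v0 v3
  + dot eps y v2 *: star eps v0 v1 v3 + dot eps y v3 *: star eps v2 v1 v0.
Proof.
move=> heps; have ee : eps ^+ 2 = 1.
  by case: heps => ->; rewrite ?expr1n // sqrrN expr1n.
apply: ncoord_ext; rewrite !ncoordD !ncoordZ !ncoord_starE //= !dotE !volE /=.
all: rewrite !ncoord_delta // !inordK //= ?mulr1n ?mulr0n.
all: by ring: ee.
Qed.

(** * Causal inequalities and uniqueness of the received times *)

Lemma eps_dotE {R : realType} (eps : R) (u v : 'rV[R]_4) :
  eps = 1 \/ eps = -1 ->
  eps * dot eps u v = - (ncoord u 0 * ncoord v 0) + ncoord u 1 * ncoord v 1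
    + ncoord u 2 * ncoord v 2 + ncoord u 3 * ncoord v 3.
Proof. by move=> heps; rewrite dotE; case: heps => ->; ring. Qed.

Lemma future_coord {R : realType} (eps : R) (v : 'rV[R]_4) :
  eps = 1 \/ eps = -1 -> future_pointing eps v -> 0 < ncoord v 0.
Proof.
move=> heps; rewrite /future_pointing eps_dotE // /time_axis !ncoord_delta //=.
by lra.
Qed.

(** Cauchy-Schwarz on the spatial parts: the spatial length of u equals its time component, while
    that of v is strictly below its own. *)
Lemma dot_null_timelike_lt0 {R : realType} (eps : R) (u v : 'rV[R]_4) :
  eps = 1 \/ eps = -1 -> 0 < ncoord u 0 -> 0 < ncoord v 0 ->
  sq eps u = 0 -> eps * sq eps v < 0 -> eps * dot eps u v < 0.
Proof.
move=> heps u0 v0 /(congr1 (fun z => eps * z)); rewrite mulr0 /sq !eps_dotE //.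
move: (ncoord u 0) (ncoord v 0) u0 v0 => a b a0 b0.
move: (ncoord u 1) (ncoord u 2) (ncoord u 3) => u1 u2 u3.
move: (ncoord v 1) (ncoord v 2) (ncoord v 3) => v1 v2 v3 uu vv.
have cs : (u1 * v1 + u2 * v2 + u3 * v3) ^+ 2
          <= (u1 * u1 + u2 * u2 + u3 * u3) * (v1 * v1 + v2 * v2 + v3 * v3).
  (* Lagrange's identity. *)
  rewrite -subr_ge0 [X in 0 <= X](_ : _ = (u1 * v2 - u2 * v1) ^+ 2
    + (u1 * v3 - u3 * v1) ^+ 2 + (u2 * v3 - u3 * v2) ^+ 2); last by ring.
  by rewrite !addr_ge0 // sqr_ge0.
have uE : u1 * u1 + u2 * u2 + u3 * u3 = a ^+ 2 by rewrite expr2; lra.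
have vb : v1 * v1 + v2 * v2 + v3 * v3 < b ^+ 2 by rewrite expr2; lra.
have lt2 : (u1 * v1 + u2 * v2 + u3 * v3) ^+ 2 < (a * b) ^+ 2.
  by rewrite (le_lt_trans cs)// uE exprMn ltr_pM2l // exprn_gt0.
suff : u1 * v1 + u2 * v2 + u3 * v3 < a * b by lra.
rewrite ltNge; apply/negP => le; move: lt2; rewrite ltNge => /negP; apply.
by rewrite lerXn2r // nnegrE ?mulr_ge0 // ?ltW // (lt_le_trans _ le) // mulr_gt0.
Qed.

Lemma dotC {R : realType} (eps : R) (u v : 'rV[R]_4) : dot eps u v = dot eps v u.
Proof. by rewrite !dotE; ring. Qed.

Lemma dotDr {R : realType} (eps : R) (u v w : 'rV[R]_4) :
  dot eps u (v + w) = dot eps u v + dot eps u w.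
Proof. by rewrite !dotE !ncoordD; ring. Qed.

Lemma dotNr {R : realType} (eps : R) (u v : 'rV[R]_4) :
  dot eps u (- v) = - dot eps u v.
Proof. by rewrite !dotE !ncoordN; ring. Qed.

Lemma dotZr {R : realType} (eps a : R) (u v : 'rV[R]_4) :
  dot eps u (a *: v) = a * dot eps u v.
Proof. by rewrite !dotE !ncoordZ; ring. Qed.

Lemma world_line_dot_decr {R : realType} (eps : R) (I : set R)
    (g : R -> 'rV[R]_4) (n : 'rV[R]_4) (s t : R) :
  eps = 1 \/ eps = -1 -> world_line eps I g -> sq eps n = 0 -> 0 < ncoord n 0 ->
  I s -> I t -> s < t -> eps * dot eps n (g t) < eps * dot eps n (g s).
Proof.
move=> heps [_ itvI smooth proper future] n0 npos Is It lt_st.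
have inI r : r \in `[s, t] -> I r.
  by rewrite in_itv /= => /andP[sr rt]; apply: (itvI s t) => //; rewrite sr rt.
pose c i := eps * (eps * ((if i == ord0 then -1 else 1) * n ord0 i)).
(* As a linear combination of the coordinate functions, f is differentiated termwise; its derivative
   is the inner product with the velocity, negative by [dot_null_timelike_lt0]. *)
pose f : R -> R := \sum_(i < 4) (c i \*: (fun r => g r ord0 i : R^o) : R -> R).
have fE r : eps * dot eps n (g r) = f r.
  rewrite /f fct_sumE /dot !mulr_sumr; apply: eq_bigr => i _.
  by rewrite /c /= /GRing.scale /= !mulrA.
have df r : r \in `[s, t] ->
    is_derive r 1 f (eps * dot eps n (velocity g r)).
  move=> /inI Ir; rewrite /dot !mulr_sumr.
  apply: is_derive_eq.
    apply: is_derive_sum => i; apply: is_deriveZ.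
    by apply/derivableP; exact: (smooth i 0).
  apply: eq_bigr => i _; rewrite mxE derive1E /c /GRing.scale /=.
  by rewrite !mulrA.
have df_oo r : r \in `]s, t[ -> is_derive r 1 f (eps * dot eps n (velocity g r)).
  by move=> r_st; apply: df; exact: subset_itv_oo_cc r_st.
have cf : {within `[s, t], continuous f}%classic.
  by apply: derivable_within_continuous => r /df [].
have [r r_st fst] := MVT lt_st df_oo cf.
have {}r_st := subset_itv_oo_cc r_st.
rewrite -subr_lt0 !fE fst pmulr_llt0 ?subr_gt0 //.
apply: dot_null_timelike_lt0 => //; last by rewrite proper ?ltrN10 //; exact: inI.
by apply: (future_coord _ _ heps); apply: future; exact: inI.
Qed.

(** Each region quantifies over its own tuple of times; uniqueness identifies that tuple with the
    one the user receives. *)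
Lemma emission_coordinates_unique {R : realType} (eps : R)
    (S : positioning_system eps) (x : 'rV[R]_4) (tau tau' : 'I_4 -> R) :
  eps = 1 \/ eps = -1 ->
  emission_coordinates S x tau -> emission_coordinates S x tau' -> tau = tau'.
Proof.
move=> heps hx hx'; apply/funext => A.
have noLt t t' : dom S A t -> dom S A t' ->
    sq eps (x - pos S A t) = 0 -> future_pointing eps (x - pos S A t) ->
    sq eps (x - pos S A t') = 0 -> future_pointing eps (x - pos S A t') ->
    ~ t < t'.
  move=> It It' n0 /(future_coord _ _ heps) fn n0' /(future_coord _ _ heps) fn' lt.
  have W := pos_world_line S A.
  (* With m = x - p and m' = x - p' both null, monotonicity against m yields eps m.m' > 0, and
     against m' it yields eps m.m' < 0. *)
  have := world_line_dot_decr _ _ _ _ _ _ heps W n0 fn It It' lt.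
  have := world_line_dot_decr _ _ _ _ _ _ heps W n0' fn' It It' lt.
  move: n0 n0' {fn fn'}; move: (pos S A t) (pos S A t') => p p'.
  have [m ->] : exists m, p = x - m by exists (x - p); rewrite subKr.
  have [m' ->] : exists m, p' = x - m by exists (x - p'); rewrite subKr.
  rewrite !subKr /sq !dotDr !dotNr (dotC _ m' m) => -> ->.
  by rewrite !mulrDr !mulrN; lra.
have [It n0 fn] := hx A; have [It' n0' fn'] := hx' A.
have [lt|gt|//] := ltgtP (tau A) (tau' A).
- by case: (noLt (tau A) (tau' A)).
- by case: (noLt (tau' A) (tau A)).
Qed.

(** * The closed formula for x - gamma_4 *)

(** These are the components of v with its index lowered. Pairing with v gives the Euclidean square,
    which stays positive for a nonzero null v, where v.v vanishes. *)
Definition euclidean_dual {R : realType} (eps : R) (v : 'rV[R]_4) : 'rV[R]_4 :=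
  \row_(i < 4) (eps * ((if i == ord0 then -1 else 1) * v ord0 i)).

Lemma dot_dual {R : realType} (eps : R) (v : 'rV[R]_4) :
  eps = 1 \/ eps = -1 ->
  dot eps v (euclidean_dual eps v) = ncoord v 0 ^+ 2 + ncoord v 1 ^+ 2
    + ncoord v 2 ^+ 2 + ncoord v 3 ^+ 2.
Proof.
move=> heps; rewrite dotE /euclidean_dual /ncoord !mxE -!val_eqE /= !inordK //=.
by case: heps => ->; ring.
Qed.

(* Since dot y xi is unknown, Cramer's expansion of 2 y in the directions dual
   to [xi, e_1, e_2, e_3] is truncated to the terms in sq e_a = 2 dot y e_a;
   what is left out is a multiple of chi. *)
Definition particular {R : realType} (eps : R) (xi e1 e2 e3 : 'rV[R]_4) :=
  sq eps e1 *: star eps e2 xi e3 + sq eps e2 *: star eps xi e1 e3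
  + sq eps e3 *: star eps e2 e1 xi.

(* With a, b, c as below, (b + t a)^2 = b^2 - a c for each root t. *)
Definition multiplier {R : realType} (eps : R) (chi p : 'rV[R]_4) : R :=
  let a := sq eps chi in
  let b := dot eps p chi in
  let c := sq eps p in
  let s := Num.sqrt (b * b - a * c) in
  if 0 < - (eps * a) then
    ((if 0 < chi ord0 ord0 then - (eps * s) else eps * s) - b) * a^-1
  else - (c * (2 * b)^-1).

Definition location {R : realType} (eps : R) (e1 e2 e3 : 'rV[R]_4) : 'rV[R]_4 :=
  let chi := star eps e1 e2 e3 in
  let xi := euclidean_dual eps chi in
  let p := particular eps xi e1 e2 e3 in
  (2 * dot eps chi xi)^-1 *: (p + multiplier eps chi p *: chi).

(** Since y is null, b^2 - a c = (y.chi)^2, so the square root yields |y.chi|. Once its sign is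
    known, t follows from y.chi = b + t a. *)
Lemma multiplierP {R : realType} (eps t : R) (chi p y : 'rV[R]_4) :
  eps = 1 \/ eps = -1 ->
  eps * sq eps chi < 0 \/ sq eps chi = 0 ->
  0 < ncoord y 0 -> sq eps y = 0 -> dot eps y chi != 0 ->
  y = p + t *: chi -> multiplier eps chi p = t.
Proof.
move=> heps causal y0 yy ychi yE.
have cE : sq eps p = - (2 * t * dot eps p chi + t ^+ 2 * sq eps chi).
  apply/eqP; rewrite -subr_eq0 -{}yy yE /sq !dotE !ncoordD !ncoordZ.
  by apply/eqP; ring.
have sE : dot eps y chi = dot eps p chi + t * sq eps chi.
  by rewrite yE /sq !dotE !ncoordD !ncoordZ; ring.
have dE : dot eps p chi * dot eps p chi - sq eps chi * sq eps p
    = dot eps y chi ^+ 2 by rewrite sE cE; ring.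
rewrite /multiplier dE sqrtr_sqr oppr_gt0.
case: causal => [tl|null].
  have a0 : sq eps chi != 0.
    by apply: contraTneq tl => ->; rewrite mulr0 ltxx.
  (* eps y.chi is negative for future-pointing chi and positive for past-pointing chi. *)
  have -> : (if 0 < chi ord0 ord0 then - (eps * `|dot eps y chi|)
             else eps * `|dot eps y chi|) = dot eps y chi.
    have <- : ncoord chi 0 = chi ord0 ord0.
      by congr (chi _ _); apply: val_inj; rewrite /= inordK.
    case: ltP => chi0.
      have := dot_null_timelike_lt0 _ _ _ heps y0 chi0 yy tl.
      case: heps => ->; rewrite ?mul1r ?mulN1r ?oppr_lt0 => h.
        by rewrite ltr0_norm // opprK.
      by rewrite gtr0_norm // opprK.
    (* Here -chi is future-pointing: a zero time component would make eps chi^2 nonnegative. *)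
    have {}chi0 : 0 < ncoord (- chi) 0.
      rewrite ncoordN oppr_gt0 lt_neqAle chi0 andbT.
      apply: contraTneq tl => z; rewrite -leNgt eps_dotE // z -!expr2.
      by rewrite expr0n oppr0 add0r !addr_ge0 ?sqr_ge0.
    have tl' : eps * sq eps (- chi) < 0.
      by rewrite /sq dotNr dotC dotNr opprK.
    have := dot_null_timelike_lt0 _ _ _ heps y0 chi0 yy tl'.
    rewrite dotNr; case: heps => ->; rewrite ?mul1r ?mulN1r ?opprK ?oppr_lt0 => h.
      by rewrite gtr0_norm.
    by rewrite ltr0_norm // opprK.
  by rewrite tl sE; field.
(* For null chi, b equals y.chi and the equation reduces to c + 2 t b = 0. *)
have b0 : dot eps p chi != 0 by rewrite sE null mulr0 addr0 in ychi.
by rewrite null mulr0 ltxx cE null; field.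
Qed.

Lemma locationP {R : realType} (eps : R) (e1 e2 e3 y : 'rV[R]_4) :
  eps = 1 \/ eps = -1 ->
  eps * sq eps (star eps e1 e2 e3) < 0 \/ sq eps (star eps e1 e2 e3) = 0 ->
  0 < ncoord y 0 -> sq eps y = 0 -> vol y e1 e2 e3 != 0 ->
  sq eps (y - e1) = 0 -> sq eps (y - e2) = 0 -> sq eps (y - e3) = 0 ->
  location eps e1 e2 e3 = y.
Proof.
move=> heps causal y0 yy; rewrite -(starP _ _ _ _ heps) dotC => ychi.
have sqE e : sq eps (y - e) = 0 -> sq eps e = 2 * dot eps y e.
  have -> : sq eps (y - e) = sq eps y - 2 * dot eps y e + sq eps e.
    by rewrite /sq !dotE !ncoordD !ncoordN; ring.
  by rewrite yy; lra.
move=> /sqE e1E /sqE e2E /sqE e3E; rewrite /location.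
set chi := star eps e1 e2 e3 in causal ychi *.
set xi := euclidean_dual eps chi; set p := particular _ _ _ _ _.
(* The Euclidean square of chi vanishes only for chi = 0, which y.chi != 0 excludes. *)
have n0 : 0 < 2 * dot eps chi xi.
  rewrite mulr_gt0 // lt_neqAle dot_dual // !addr_ge0 ?sqr_ge0 // andbT eq_sym.
  apply: contra ychi; rewrite !paddr_eq0 ?addr_ge0 ?sqr_ge0 // !sqrf_eq0.
  move=> /andP[/andP[/andP[/eqP c0 /eqP c1] /eqP c2] /eqP c3].
  by rewrite dotE c0 c1 c2 c3 !mulr0 !addr0 oppr0 mulr0.
have yE : (2 * dot eps chi xi) *: y = p + (2 * dot eps y xi) *: chi.
  rewrite -scalerA starP // (cramer _ _ _ _ _ _ heps) /p /particular e1E e2E e3E.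
  by rewrite !scalerDr !scalerA -/chi [RHS]addrC !addrA.
(* The positive multiple 2 N y is again null and future-pointing, with nonzero product with chi. *)
rewrite (multiplierP eps (2 * dot eps y xi) chi p ((2 * dot eps chi xi) *: y)) //.
- by rewrite -yE scalerA mulVf ?scale1r // gt_eqF.
- by rewrite ncoordZ mulr_gt0.
- by rewrite /sq dotZr (dotC _ (_ *: _)) dotZr -/(sq eps y) yy !mulr0.
- by rewrite (dotC _ _ chi) dotZr (dotC _ chi y) mulf_neq0 // gt_eqF.
Qed.

(** Subtracting the last row from the others leaves -vol a b c y, and moving y to the front takes
    three transpositions. This turns the independence of the four signals into y.chi != 0. *)
Lemma vol_sub {R : realType} (y a b c : 'rV[R]_4) :
  vol (y - a) (y - b) (y - c) y = vol y a b c.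
Proof. by rewrite !volE /= !ncoordD !ncoordN; ring. Qed.

(** * The closed formula as a program *)

Section Programs.
Variable z : int.

Definition pdot (u v : 'I_4 -> program) : program :=
  Mul (Const z) (\big[Add/Const 0]_(i < 4)
    Mul (Const (if i == ord0 then -1 else 1)) (Mul (u i) (v i))).

(** The Leibniz formula, so that evaluation matches the definition of [\det] term by term. *)
Definition pdet (m : 'I_4 -> 'I_4 -> program) : program :=
  \big[Add/Const 0]_(s : 'S_4)
    Mul (Const ((-1) ^+ s)) (\big[Mul/Const 1]_(i < 4) m i (s i)).

(** Row 3 lies past the end of the list, so [nth] returns its default [w]. *)
Definition pstar (u v w : 'I_4 -> program) (i : 'I_4) : program :=
  Mul (Mul (Const z) (Const (if i == ord0 then -1 else 1)))
    (pdet (fun k j => nth w [:: fun l => Const (l == i)%:R; u; v] k j)).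

Definition pdual (u : 'I_4 -> program) (i : 'I_4) : program :=
  Mul (Const z) (Mul (Const (if i == ord0 then -1 else 1)) (u i)).

Definition pparticular (xi e1 e2 e3 : 'I_4 -> program) (i : 'I_4) : program :=
  Add (Add (Mul (pdot e1 e1) (pstar e2 xi e3 i))
           (Mul (pdot e2 e2) (pstar xi e1 e3 i)))
      (Mul (pdot e3 e3) (pstar e2 e1 xi i)).

Definition pmultiplier (chi p : 'I_4 -> program) : program :=
  let a := pdot chi chi in
  let b := pdot p chi in
  let c := pdot p p in
  let s := Sqrt (Add (Mul b b) (Opp (Mul a c))) in
  IfPos (Opp (Mul (Const z) a))
    (Mul (Add (IfPos (chi ord0) (Opp (Mul (Const z) s)) (Mul (Const z) s))
              (Opp b)) (Inv a))
    (Opp (Mul c (Inv (Mul (Const 2) b)))).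

Definition plocation (e1 e2 e3 : 'I_4 -> program) (i : 'I_4) : program :=
  let chi := pstar e1 e2 e3 in
  let xi := pdual chi in
  let p := pparticular xi e1 e2 e3 in
  Mul (Inv (Mul (Const 2) (pdot chi xi)))
    (Add (p i) (Mul (pmultiplier chi p) (chi i))).

Variables (R : realType) (eps : R) (S : positioning_system eps).
Variable tau : 'I_4 -> R.
Hypothesis zE : z%:~R = eps.

Definition run_vec (u : 'I_4 -> program) : 'rV[R]_4 :=
  \row_(i < 4) run S tau (u i).

Lemma run_sum (I : finType) (F : I -> program) :
  run S tau (\big[Add/Const 0]_i F i) = \sum_i run S tau (F i).
Proof. exact: (big_morph (run S tau)). Qed.

Lemma run_prod (I : finType) (F : I -> program) :
  run S tau (\big[Mul/Const 1]_i F i) = \prod_i run S tau (F i).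
Proof. exact: (big_morph (run S tau)). Qed.

Lemma intr_metric_sign (b : bool) :
  (if b then -1 else 1 : int)%:~R = (if b then -1 else 1) :> R.
Proof. by case: b. Qed.

Lemma run_dot u v : run S tau (pdot u v) = dot eps (run_vec u) (run_vec v).
Proof.
rewrite /pdot /dot /= zE run_sum; congr (_ * _); apply: eq_bigr => i _.
by rewrite /= intr_metric_sign !mxE.
Qed.

Lemma run_det m : run S tau (pdet m) = \det (\matrix_(i, j) run S tau (m i j)).
Proof.
rewrite /pdet run_sum; apply: eq_bigr => s _ /=.
rewrite run_prod rmorph_sign; congr (_ * _).
by apply: eq_bigr => i _; rewrite mxE.
Qed.

Lemma run_vec_star u v w :
  run_vec (pstar u v w) = star eps (run_vec u) (run_vec v) (run_vec w).
Proof.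
apply/rowP => i; rewrite !mxE /= zE intr_metric_sign.
congr (_ * _); rewrite run_det; congr (\det _); apply/matrixP => k j.
by rewrite !mxE; case: k => [[|[|[|[|]]]] ltk] //=; rewrite !mxE //= rmorph_nat.
Qed.

Lemma run_vec_dual u : run_vec (pdual u) = euclidean_dual eps (run_vec u).
Proof. by apply/rowP => i; rewrite !mxE /= zE intr_metric_sign. Qed.

Lemma run_vec_particular xi e1 e2 e3 :
  run_vec (pparticular xi e1 e2 e3) =
  particular eps (run_vec xi) (run_vec e1) (run_vec e2) (run_vec e3).
Proof.
rewrite /particular -!run_vec_star /sq -!run_dot.
by apply/rowP => i; rewrite !mxE.
Qed.

Lemma run_multiplier chi p :
  run S tau (pmultiplier chi p) = multiplier eps (run_vec chi) (run_vec p).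
Proof. by rewrite /multiplier /sq -!run_dot mxE /= zE. Qed.

Lemma run_vec_location e1 e2 e3 :
  run_vec (plocation e1 e2 e3) =
  location eps (run_vec e1) (run_vec e2) (run_vec e3).
Proof.
rewrite /location -run_vec_star -run_vec_dual -run_vec_particular.
by rewrite -run_dot -run_multiplier; apply/rowP => i; rewrite !mxE.
Qed.

End Programs.

Theorem proposition10 (R : realType) (eps : R) (heps : eps = 1 \/ eps = -1) :
  exists position : 'I_4 -> program,
    forall (S : positioning_system eps) (x : 'rV[R]_4) (tau : 'I_4 -> R),
      central_region S x -> emission_coordinates S x tau ->
      forall alpha : 'I_4, run S tau (position alpha) = x ord0 alpha.
Proof.
(* Programs contain only integer constants, so the sign [eps] is written into them as z. *)
have [z zE] : exists z : int, z%:~R = eps.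
  by case: heps => ->; [exists 1 | exists (-1)]; rewrite ?mulrN1z.
pose g A i := Pos A i (Time A).
pose e A i := Add (g A i) (Opp (g em4 i)).
exists (fun i => Add (g em4 i) (plocation z (e em1) (e em2) (e em3) i)).
move=> S x tau central hx alpha.
have eE A : run_vec R eps S tau (e A) = rel_pos S tau A.
  by apply/rowP => i; rewrite !mxE.
(* Adding gamma_4 to the signal m_4 recovers x. *)
suff main : location eps (rel_pos S tau em1) (rel_pos S tau em2)
    (rel_pos S tau em3) = signal S x tau em4.
  have := run_vec_location z R eps S tau zE (e em1) (e em2) (e em3).
  rewrite !eE main /signal => /rowP /(_ alpha); rewrite !mxE => locE.
  have addE p q : run S tau (Add p q) = run S tau p + run S tau q by [].
  by rewrite addE locE [LHS]addrC; exact: subrK.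
(* m_a = m_4 - e_a, so nullity of all signals supplies the hypotheses of [locationP] for y = m_4. *)
have sigE A : signal S x tau A = signal S x tau em4 - rel_pos S tau A.
  by apply/rowP => i; rewrite !mxE; ring.
have [[tau1 h1 indep] causal] : coordinate_region S x /\
    (eps * sq eps (configuration S tau) < 0 \/ sq eps (configuration S tau) = 0).
  case: central => -[cx [tau2 h2 h]]; split=> //.
    by left; rewrite (emission_coordinates_unique _ _ _ _ _ heps hx h2).
  by right; rewrite (emission_coordinates_unique _ _ _ _ _ heps hx h2).
move: indep; rewrite -(emission_coordinates_unique _ _ _ _ _ heps hx h1).
rewrite (sigE em1) (sigE em2) (sigE em3) vol_sub => indep.
have null A : sq eps (signal S x tau A) = 0 by case: (hx A).
apply: (locationP _ _ _ _ _ heps causal _ _ indep) => //; rewrite -?sigE //.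
by case: (hx em4) => _ _ /(future_coord _ _ heps).
Qed.
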